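(* Let $\mathbb{F}$ be a field of characteristic $0$, let $n,k\ge 1$, and let $\Phi:M_n(\mathbb{F})\to M_k(\mathbb{F})$ be a trivial multiplicative map with $\Phi(0)=0$ and $\Phi(I_n)=I_k$. Then there is a multiplicative map $\overline{\Phi}:\mathbb{F}\to M_k(\mathbb{F})$ with $\overline{\Phi}(1)=I_k$ such that $\Phi(A)=\overline{\Phi}(\det(A))$ for all $A\in M_n(\mathbb{F})$.
   Context: $M_m(\mathbb{F})$ is the algebra of $m\times m$ matrices over $\mathbb{F}$ and $I_m$ is the identity matrix. A map $\Psi$ between multiplicative semigroups (such as $M_n(\mathbb{F})$, $M_k(\mathbb{F})$ or $\mathbb{F}$) is multiplicative if $\Psi(xy)=\Psi(x)\Psi(y)$ for all $x,y$ (no linearity is assumed). A multiplicative map $\Phi:M_n(\mathbb{F})\to M_k(\mathbb{F})$ is called trivial if $\Phi(A)=I_k$ for every $A\in\operatorname{SL}(n,\mathbb{F})$. *)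

(* Defs.v *)
From mathcomp Require Import all_boot all_order all_algebra.
Set Implicit Arguments.
Unset Strict Implicit.
Unset Printing Implicit Defensive.
Import GRing.Theory.
Local Open Scope ring_scope.

(* Only multiplicativity is required: neither additivity nor the preservation
   of the identity. *)
Definition multiplicative_mx (F : fieldType) (n k : nat)
    (Phi : 'M[F]_n -> 'M[F]_k) : Prop :=
  {morph Phi : A B / A *m B >-> A *m B}.

(* SL(n, F) is the set of matrices of determinant 1. *)
Definition trivial_mx (F : fieldType) (n k : nat)
    (Phi : 'M[F]_n -> 'M[F]_k) : Prop :=
  forall A : 'M[F]_n, \det A = 1 -> Phi A = 1%:M.

(* Main.v *)
Require Import Defs.
From mathcomp Require Import all_boot all_order all_algebra.
From mathcomp Require Import perm.
Set Implicit Arguments.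
Unset Strict Implicit.
Unset Printing Implicit Defensive.
Import GRing.Theory.
Local Open Scope ring_scope.

(** For invertible [A] of determinant [x], [A] differs from the dilation
    [diag(1, .., x, .., 1)] by a factor in SL, so [Phi A] is the value of [Phi]
    at this dilation.  For singular [A], let [E_i] be the diagonal idempotent
    whose only zero diagonal entry is the [i]-th.  The [E_i] are conjugate under
    SL, hence share the same idempotent image; their product is [0], so this
    image is [Phi 0 = 0].  As [A] factors through some [E_i], [Phi A = 0]. *)

(** At [x = 0] this is the idempotent [E_i], so [dilationM] also serves the singular case. *)
Definition dilation_mx (F : fieldType) (n : nat) (i : 'I_n) (x : F) : 'M[F]_n :=
  diag_mx (\row_j (if j == i then x else 1)).

Lemma det_dilation (F : fieldType) (n : nat) (i : 'I_n) (x : F) :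
  \det (dilation_mx i x) = x.
Proof.
rewrite det_diag (bigD1 i) //= mxE eqxx big1 ?mulr1 // => j /negPf ji.
by rewrite mxE ji.
Qed.

Lemma dilationM (F : fieldType) (n : nat) (i : 'I_n) (x y : F) :
  dilation_mx i (x * y) = dilation_mx i x *m dilation_mx i y.
Proof.
rewrite mulmx_diag; congr diag_mx; apply/rowP=> j; rewrite !mxE.
by case: eqP => // _; rewrite mulr1.
Qed.

Lemma dilation1 (F : fieldType) (n : nat) (i : 'I_n) :
  dilation_mx i 1 = 1%:M :> 'M[F]_n.
Proof. by apply/matrixP=> a b; rewrite !mxE if_same. Qed.

Lemma dilation_tperm (F : fieldType) (n : nat) (i j : 'I_n) (x : F) :
  dilation_mx j x = tperm_mx i j *m dilation_mx i x *m tperm_mx i j.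
Proof.
have := col_permE (tperm i j) (dilation_mx i x); rewrite tpermV => colE.
rewrite /tperm_mx -mulmxA -colE -row_permE.
apply/matrixP=> a b; rewrite !mxE (inj_eq perm_inj).
by rewrite (can2_eq (tpermK i j) (tpermK i j)) tpermL.
Qed.

(** Column [r] of [pid_mx r], counted from 0, is already zero. This lets a matrix of rank [r < n]
    factor through some [E_i]. *)
Lemma pid_mx_dilation0 (F : fieldType) (m n r : nat) (lt_rn : (r < n)%N) :
  pid_mx r *m dilation_mx (Ordinal lt_rn) 0 = pid_mx r :> 'M[F]_(m, n).
Proof.
apply/matrixP=> a b; rewrite mul_mx_diag !mxE -val_eqE /=.
case: (val b =P r) => [br|_]; last by rewrite mulr1.
by rewrite mulr0; case: eqP => //= ->; rewrite br ltnn.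
Qed.

Section TrivialMap.

Variables (F : fieldType) (n k : nat) (Phi : 'M[F]_n -> 'M[F]_k).
Hypotheses (PhiM : multiplicative_mx Phi) (Phi_triv : trivial_mx Phi).

Lemma trivial_mx_unit (i : 'I_n) (A : 'M[F]_n) :
  \det A != 0 -> Phi A = Phi (dilation_mx i (\det A)).
Proof.
move=> dA; set x := \det A.
have -> : A = A *m dilation_mx i x^-1 *m dilation_mx i x.
  by rewrite -mulmxA -dilationM mulVf // dilation1 mulmx1.
rewrite PhiM Phi_triv ?mul1mx //.
by rewrite det_mulmx det_dilation mulfV.
Qed.

(* The zero entry of the dilation absorbs the determinant of [B]. *)
Lemma trivial_mx_mul_dilation0 (i : 'I_n) (B : 'M[F]_n) : \det B != 0 ->
  Phi (B *m dilation_mx i 0) = Phi (dilation_mx i 0).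
Proof.
move=> dB; rewrite -[0 in LHS](mulr0 (\det B)^-1) dilationM mulmxA.
rewrite PhiM Phi_triv ?mul1mx //.
by rewrite det_mulmx det_dilation mulfV.
Qed.

Lemma trivial_mx_dilation0_mul (i : 'I_n) (B : 'M[F]_n) : \det B != 0 ->
  Phi (dilation_mx i 0 *m B) = Phi (dilation_mx i 0).
Proof.
move=> dB; rewrite -[0 in LHS](mul0r (\det B)^-1) dilationM -mulmxA.
rewrite PhiM [Phi (_ *m B)]Phi_triv ?mulmx1 //.
by rewrite det_mulmx det_dilation mulVf.
Qed.

Lemma trivial_mx_dilation0_eq (i j : 'I_n) :
  Phi (dilation_mx j 0) = Phi (dilation_mx i 0).
Proof.
have dP : \det (tperm_mx i j : 'M[F]_n) != 0 by rewrite det_perm signr_eq0.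
(* A transposition may have determinant -1 and so lie outside SL; the zero entry absorbs the two
   outer factors one at a time. *)
rewrite (dilation_tperm i j) -mulmxA PhiM trivial_mx_dilation0_mul // -PhiM.
exact: trivial_mx_mul_dilation0.
Qed.

Hypothesis Phi0 : Phi 0 = 0.

Lemma trivial_mx_dilation0 (i : 'I_n) : Phi (dilation_mx i 0) = 0.
Proof.
(* [G s] is the product of the [E_j] for [j] in [s]: the identity for empty [s], and [0] once [s]
   lists all indices. *)
pose G (s : seq 'I_n) : 'M[F]_n := diag_mx (\row_j (j \notin s)%:R).
have idE : Phi (dilation_mx i 0) *m Phi (dilation_mx i 0)
    = Phi (dilation_mx i 0) by rewrite -PhiM -dilationM mulr0.
(* The trailing factor makes the claim hold for empty [s] too, where [Phi (G s)] is the identity. *)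
have GE s : Phi (G s) *m Phi (dilation_mx i 0) = Phi (dilation_mx i 0).
  elim: s => [|j s IHs].
    by rewrite Phi_triv ?mul1mx // det_diag big1 // => l _; rewrite mxE.
  have -> : G (j :: s) = dilation_mx j 0 *m G s.
    rewrite mulmx_diag; congr diag_mx; apply/rowP=> l; rewrite !mxE inE.
    by case: eqP => //= _; rewrite ?mul0r ?mul1r.
  by rewrite PhiM (trivial_mx_dilation0_eq i j) -mulmxA IHs.
rewrite -(GE (enum 'I_n)); have -> : G (enum 'I_n) = 0.
  by apply/matrixP=> a b; rewrite !mxE mem_enum mul0rn.
by rewrite Phi0 mul0mx.
Qed.

Lemma trivial_mx_singular (A : 'M[F]_n) : \det A = 0 -> Phi A = 0.
Proof.
move=> dA; have lt_rn : (\rank A < n)%N.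
  rewrite ltn_neqAle rank_leq_row andbT -[_ == _]/(row_free A).
  by rewrite row_free_unit unitmxE dA unitr0.
(* Gaussian elimination gives [A] as [pid_mx (\rank A)] between invertible factors; the inserted
   [E_i] has index [\rank A]. *)
rewrite -[A]mulmx_ebase -(pid_mx_dilation0 _ _ lt_rn) !PhiM.
by rewrite trivial_mx_dilation0 !mulmx0 mul0mx.
Qed.

End TrivialMap.

Theorem mainTheorem4 (F : fieldType) (charF : [pchar F] =i pred0)
    (n k : nat) (n_gt0 : (0 < n)%N) (k_gt0 : (0 < k)%N)
    (Phi : 'M[F]_n -> 'M[F]_k)
    (PhiM : multiplicative_mx Phi) (Phi_triv : trivial_mx Phi)
    (Phi0 : Phi 0 = 0) (Phi1 : Phi 1%:M = 1%:M) :
  exists Phibar : F -> 'M[F]_k,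
    [/\ {morph Phibar : x y / x * y >-> x *m y},
        Phibar 1 = 1%:M
      & forall A : 'M[F]_n, Phi A = Phibar (\det A)].
Proof.
(* Index 0 exists since [n > 0]; any other index gives the same map. *)
exists (fun x => Phi (dilation_mx (Ordinal n_gt0) x)); split.
- by move=> x y; rewrite dilationM PhiM.
- by rewrite dilation1.
move=> A; have [dA|dA] := eqVneq (\det A) 0; last exact: trivial_mx_unit.
by rewrite dA trivial_mx_dilation0 // trivial_mx_singular.
Qed.
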